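(* Let $(\mathfrak h,[\,,]_{\mathfrak h},\varrho_{\mathfrak h},\omega)$ be a Kähler Lie algebra, $(\mathfrak p,\varrho_{\mathfrak p})$ a Euclidean vector space, $[\,,]_{\mathfrak p}:\mathfrak p\times\mathfrak p\to\mathfrak p$ and $\mu:\mathfrak p\times\mathfrak p\to\mathfrak h$ skew-symmetric bilinear maps, and $\phi_{\mathfrak p}:\mathfrak p\to\mathrm{sp}(\mathfrak h,\omega)$, $\phi_{\mathfrak h}:\mathfrak h\to\mathrm{so}(\mathfrak p)$ linear maps. Define a skew-symmetric bracket on $\mathfrak g=\mathfrak h\oplus\mathfrak p$ by, for $a,b\in\mathfrak p$ and $u,v\in\mathfrak h$, $$[u,v]=[u,v]_{\mathfrak h},\quad [a,b]=\mu(a,b)+[a,b]_{\mathfrak p},\quad [a,u]=-[u,a]=\phi_{\mathfrak p}(a)(u)-\phi_{\mathfrak h}(u)(a).$$ Then this bracket is a Lie bracket if and only if, for any $u,v\in\mathfrak h$ and $a,b,c\in\mathfrak p$, $$\begin{cases} \phi_{\mathfrak p}(a)([u,v]_{\mathfrak h})=[u,\phi_{\mathfrak p}(a)(v)]_{\mathfrak h}+[\phi_{\mathfrak p}(a)(u),v]_{\mathfrak h}+\phi_{\mathfrak p}(\phi_{\mathfrak h}(v)(a))(u)-\phi_{\mathfrak p}(\phi_{\mathfrak h}(u)(a))(v),\\ \phi_{\mathfrak h}(u)([a,b]_{\mathfrak p})=[a,\phi_{\mathfrak h}(u)(b)]_{\mathfrak p}+[\phi_{\mathfrak h}(u)(a),b]_{\mathfrak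 p}+\phi_{\mathfrak h}(\phi_{\mathfrak p}(b)(u))(a)-\phi_{\mathfrak h}(\phi_{\mathfrak p}(a)(u))(b),\\ \phi_{\mathfrak h}([u,v]_{\mathfrak h})=[\phi_{\mathfrak h}(u),\phi_{\mathfrak h}(v)],\\ \phi_{\mathfrak p}([a,b]_{\mathfrak p})(u)=[\phi_{\mathfrak p}(a),\phi_{\mathfrak p}(b)](u)+[u,\mu(a,b)]_{\mathfrak h}-\mu(a,\phi_{\mathfrak h}(u)(b))-\mu(\phi_{\mathfrak h}(u)(a),b),\\ \oint [a,[b,c]_{\mathfrak p}]_{\mathfrak p}=\oint\phi_{\mathfrak h}(\mu(b,c))(a),\\ \oint\phi_{\mathfrak p}(a)(\mu(b,c))=\oint\mu([b,c]_{\mathfrak p},a), \end{cases}$$ where $\oint$ denotes the sum over circular permutations of $(a,b,c)$.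
   Context: All vector spaces are real and finite-dimensional. $\mathrm{sp}(\mathfrak h,\omega)=\{J\in\mathrm{End}(\mathfrak h):\omega(Ju,v)+\omega(u,Jv)=0\ \forall u,v\}$ and $\mathrm{so}(\mathfrak p)=\{A\in\mathrm{End}(\mathfrak p):\varrho_{\mathfrak p}(Aa,b)+\varrho_{\mathfrak p}(a,Ab)=0\ \forall a,b\}$; brackets of endomorphisms are commutators. A Kähler Lie algebra $(\mathfrak h,[\,,]_{\mathfrak h},\varrho_{\mathfrak h},\omega)$ is a Lie algebra with a Euclidean product $\varrho_{\mathfrak h}$ and a nondegenerate skew-symmetric bilinear form $\omega$ such that $\omega(A_uv,w)+\omega(v,A_uw)=0$ for all $u,v,w\in\mathfrak h$, where $A$ is the Levi-Civita product: $2\varrho_{\mathfrak h}(A_uv,w)=\varrho_{\mathfrak h}([u,v]_{\mathfrak h},w)+\varrho_{\mathfrak h}([w,u]_{\mathfrak h},v)+\varrho_{\mathfrak h}([w,v]_{\mathfrak h},u)$. *)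

(* Defs.v *)
From HB Require Import structures.
From mathcomp Require Export all_boot all_order all_algebra.
From mathcomp Require Export reals.

Set Implicit Arguments.
Unset Strict Implicit.
Unset Printing Implicit Defensive.

Import Order.TTheory GRing.Theory Num.Theory.
Local Open Scope ring_scope.

Definition skew_map (R : nzRingType) (U V : lmodType R) (f : U -> U -> V) :=
  forall x y, f x y = - f y x.

Definition cyclic_sum (T : Type) (V : zmodType) (f : T -> T -> T -> V) a b c :=
  f a b c + f b c a + f c a b.

Definition is_lie_bracket (R : nzRingType) (V : lmodType R)
    (br : {bilinear V -> V -> V}) :=
  skew_map br /\
  forall x y z, cyclic_sum (fun x y z => br x (br y z)) x y z = 0.

Definition commutator (R : fieldType) (V : vectType R) (f g : 'End(V)) : 'End(V) :=
  (f \o g)%VF - (g \o f)%VF.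

(* Endomorphisms that are infinitesimally B-preserving: sp(V, B) when B is
   a symplectic form, so(V) when B is the Euclidean product. *)
Definition skew_for (R : fieldType) (V : vectType R) (B : V -> V -> R)
    (J : 'End(V)) :=
  forall u v, B (J u) v + B u (J v) = 0.

Definition sp (R : fieldType) (V : vectType R) (omega : {skew_symmetric V})
    (J : 'End(V)) : Prop :=
  skew_for omega J.

Definition so (R : realFieldType) (V : vectType R) (rho : {dot V for idfun})
    (J : 'End(V)) : Prop :=
  skew_for rho J.

Section Kahler.
Variables (R : realFieldType) (V : vectType R).
Variables (br : {bilinear V -> V -> V}) (rho : {dot V for idfun}).

Definition is_levi_civita (A : V -> V -> V) :=
  forall u v w, 2 * rho (A u v) w =
    rho (br u v) w + rho (br w u) v + rho (br w v) u.

Definition is_kahler (omega : {skew_symmetric V}) :=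
  [/\ is_lie_bracket br,
      nondegenerate omega &
      exists2 A : V -> V -> V, is_levi_civita A &
        forall u v w, omega (A u v) w + omega v (A u w) = 0].

Let rho_inj x y : (forall w, rho x w = rho y w) -> x = y.
Proof.
move=> e; apply/eqP; rewrite -subr_eq0; apply/negPn/negP => nz.
have := neq0_dnorm_gt0 (s := rho) _ nz.
by rewrite linearBl /= e subrr ltxx.
Qed.

(* The Levi-Civita product exists and is unique, so the existential in
   is_kahler does refer to the Levi-Civita product. *)
Lemma levi_civita_unique A A' :
  is_levi_civita A -> is_levi_civita A' -> A =2 A'.
Proof.
move=> hA hA' u v; apply: rho_inj => w.
have n2 : (2 : R) != 0 by rewrite pnatr_eq0.
by apply: (mulfI n2); rewrite hA hA'.
Qed.

Let flat (x : V) : 'Hom(V, R^o) := linfun (rho x : V -> R^o).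

Let flat_linear : linear flat.
Proof.
move=> c x y; apply/lfunP => w; rewrite add_lfunE scale_lfunE !lfunE /=.
by rewrite linearPl.
Qed.
HB.instance Definition _ := GRing.isLinear.Build R V 'Hom(V, R^o) _ flat flat_linear.

Let flatVK (l : 'Hom(V, R^o)) w : rho ((linfun flat)^-1%VF l) w = l w.
Proof.
have ker0 : lker (linfun flat) == 0%VS.
  apply/lker0P => x y; rewrite !lfunE /= => e; apply: rho_inj => z.
  by have := congr1 (fun f : 'Hom(V, R^o) => f z) e; rewrite !lfunE.
have full : limg (linfun flat) = fullv.
  apply/eqP; rewrite eqEdim subvf /= limg_dim_eq ?(eqP ker0) ?capv0 //.
  by rewrite !dimvf /dim /= muln1.
have lP : l \in limg (linfun flat) by rewrite full memvf.
by have := limg_lfunVK lP; rewrite lfunE => /= e; rewrite -[in RHS]e lfunE.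
Qed.

Lemma levi_civita_exists : exists A, is_levi_civita A.
Proof.
pose K u v : 'Hom(V, R^o) := 2^-1 *: (linfun (rho (br u v) : V -> R^o)
  + (linfun (rho v : V -> R^o) \o linfun (applyr br u))%VF
  + (linfun (rho u : V -> R^o) \o linfun (applyr br v))%VF).
have symm x y : rho x y = rho y x.
  by have := hermitian_subproof (s := rho) x y; rewrite expr0 mul1r.
exists (fun u v => (linfun flat)^-1%VF (K u v)) => u v w.
rewrite flatVK scale_lfunE !add_lfunE !comp_lfunE !lfunE /=.
set S := (X in 2^-1 *: X); rewrite -[2^-1 *: S]/(2^-1 * (S : R)) mulrA divff ?pnatr_eq0 // mul1r.
by rewrite /S (symm v) (symm u).
Qed.

End Kahler.

Section ExtensionBracket.
Variables (R : fieldType) (h p : vectType R).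
Variables (brh : {bilinear h -> h -> h}) (brp : {bilinear p -> p -> p}).
Variables (mu : {bilinear p -> p -> h}).
Variables (phip : {linear p -> 'End(h)}) (phih : {linear h -> 'End(p)}).

(* The bilinear bracket on h (+) p, modelled as h * p, obtained by expanding
   [u + a, v + b]; the lemmas ext_bracket_hh, ext_bracket_pp, ext_bracket_ph
   and ext_bracket_hp give back its values on the two summands. *)
Definition ext_bracket (x y : h * p) : h * p :=
  (brh x.1 y.1 + mu x.2 y.2 + phip x.2 y.1 - phip y.2 x.1,
   brp x.2 y.2 + phih x.1 y.2 - phih y.1 x.2).

Lemma ext_bracket_bilinear :
  bilinear_for
    (GRing.Scale.Law.clone _ _ ( *:%R ) _) (GRing.Scale.Law.clone _ _ ( *:%R ) _)
    ext_bracket.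
Proof.
have comb (U : lmodType R) c (x1 x1' x2 x2' : U) :
    (c *: x1 + x1') + (c *: x2 + x2') = c *: (x1 + x2) + (x1' + x2').
  by rewrite scalerDr addrACA.
have combN (U : lmodType R) c (x1 x1' x2 x2' : U) :
    (c *: x1 + x1') - (c *: x2 + x2') = c *: (x1 - x2) + (x1' - x2').
  by rewrite scalerBr opprD addrACA.
by split=> [y|x] c; [move=> x x'|move=> y y']; rewrite /ext_bracket;
  congr pair => /=;
  rewrite ?(linearPl, linearPr, linearP, add_lfunE, scale_lfunE) ?(comb, combN).
Qed.
HB.instance Definition _ :=
  bilinear_isBilinear.Build R (h * p)%type (h * p)%type (h * p)%type _ _
    ext_bracket ext_bracket_bilinear.

Let simpE :=
  (linear0r, linear0l, linear0, zero_lfunE, subr0, addr0, add0r, sub0r).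

Lemma ext_bracket_hh u v : ext_bracket (u, 0) (v, 0) = (brh u v, 0).
Proof. by rewrite /ext_bracket /= !simpE. Qed.

Lemma ext_bracket_pp a b : ext_bracket (0, a) (0, b) = (mu a b, brp a b).
Proof. by rewrite /ext_bracket /= !simpE. Qed.

Lemma ext_bracket_ph a u : ext_bracket (0, a) (u, 0) = (phip a u, - phih u a).
Proof. by rewrite /ext_bracket /= !simpE. Qed.

Lemma ext_bracket_hp a u : ext_bracket (u, 0) (0, a) = - (phip a u, - phih u a).
Proof. by rewrite /ext_bracket /= !simpE; congr pair; rewrite /= ?opprK. Qed.

Lemma ext_bracket_skew :
  skew_map brh -> skew_map brp -> skew_map mu -> skew_map ext_bracket.
Proof.
move=> skh skp skm x y; rewrite /ext_bracket skh skp skm; congr pair => /=.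
  by rewrite !opprD opprK -!addrA; do 2!congr (_ + _); rewrite addrC.
by rewrite !opprD opprK -!addrA; congr (_ + _); rewrite addrC.
Qed.

End ExtensionBracket.

(* Main.v *)
(* The Jacobiator of the bracket on h (+) p is trilinear and invariant under
   cyclic permutations, so it vanishes as soon as it does on triples of types
   (h,h,h), (h,h,p), (h,p,p) and (p,p,p): each of the eight types is a rotation
   of one of these.  The first is the Jacobi identity of h, and the h- and
   p-components of the other three are the six equations. *)

From mathcomp Require Import ssrAC.
Require Import Defs.

Set Implicit Arguments.
Unset Strict Implicit.
Unset Printing Implicit Defensive.

Import GRing.Theory.
Local Open Scope ring_scope.

(** It unfolds to the left side of the Jacobi clause of [is_lie_bracket], so folding it back turns
    that clause into [jacobiator br x y z = 0]. *)
Definition jacobiator (R : nzRingType) (V : lmodType R) (br : V -> V -> V) :=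
  cyclic_sum (fun x y z => br x (br y z)).

Lemma cyclic_sum_rot (T : Type) (V : zmodType) (f : T -> T -> T -> V) x y z :
  cyclic_sum f y z x = cyclic_sum f x y z.
Proof. by rewrite /cyclic_sum [LHS](ACl (3*1*2)). Qed.

Section Jacobiator.
Variables (R : comNzRingType) (V : lmodType R) (br : {bilinear V -> V -> V}).
Local Notation jac := (jacobiator br).

Lemma jacobiatorDl x x' y z : jac (x + x') y z = jac x y z + jac x' y z.
Proof.
rewrite /jacobiator /cyclic_sum !(linearDl, linearDr).
by rewrite [LHS](AC (2*2*2) ((1*3*5)*(2*4*6))).
Qed.

(** A rotation brings the middle slot to the front, where additivity is known; the last slot is then
    rotated to the middle. *)
Lemma jacobiatorDm x y y' z : jac x (y + y') z = jac x y z + jac x y' z.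
Proof.
have rot w : jac x w z = jac w z x by apply/esym/cyclic_sum_rot.
by rewrite !rot jacobiatorDl.
Qed.

Lemma jacobiatorDr x y z z' : jac x y (z + z') = jac x y z + jac x y z'.
Proof.
have rot w : jac x y w = jac y w x by apply/esym/cyclic_sum_rot.
by rewrite !rot jacobiatorDm.
Qed.

End Jacobiator.

Section ExtensionJacobiator.
Variables (R : fieldType) (h p : vectType R).
Variables (brh : {bilinear h -> h -> h}) (brp : {bilinear p -> p -> p}).
Variables (mu : {bilinear p -> p -> h}).
Variables (phip : {linear p -> 'End(h)}) (phih : {linear h -> 'End(p)}).
Hypotheses (skew_brh : skew_map brh) (skew_brp : skew_map brp).
Hypothesis skew_mu : skew_map mu.

Local Notation jac := (jacobiator (ext_bracket brh brp mu phip phih)).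

Let simpE :=
  (linear0r, linear0l, linear0, zero_lfunE, subr0, addr0, add0r, sub0r,
   @oppr0, linearNl, linearNr, linearN, opp_lfunE, @opprK).

Lemma ext_jacobiator_hhh u v w :
  jac (u, 0) (v, 0) (w, 0) = (jacobiator brh u v w, 0).
Proof.
rewrite /jacobiator /cyclic_sum !ext_bracket_hh.
by congr pair; rewrite /= !addr0.
Qed.

(** The components are the defects of the first equation and of the third, the latter evaluated at
    [a]. *)
Lemma ext_jacobiator_hhp u v a :
  jac (u, 0) (v, 0) (0, a) =
  (phip a (brh u v) -
     (brh u (phip a v) + brh (phip a u) v
      + phip (phih v a) u - phip (phih u a) v),
   (commutator (phih u) (phih v) - phih (brh u v)) a).
Proof.
rewrite /jacobiator /cyclic_sum /ext_bracket /commutator; congr pair => /=.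
  (* The cyclic sum produces [brh v (phip a u)], with the factors in the opposite order to the
     equation. *)
  rewrite !simpE (skew_brh (phip a u)) !opprD !opprK.
  by rewrite /= ?simpE [LHS](AC (2*2*1) (5*(1*3*2*4))).
by rewrite !simpE !(add_lfunE, opp_lfunE, comp_lfunE).
Qed.

(** The components are the defects of the fourth equation, up to sign, and of the second.
    Skew-symmetry of [mu] and [brp] moves [phih u a] to the left factor. *)
Lemma ext_jacobiator_hpp u a b :
  jac (u, 0) (0, a) (0, b) =
  (commutator (phip a) (phip b) u + brh u (mu a b)
     - mu a (phih u b) - mu (phih u a) b - phip (brp a b) u,
   phih u (brp a b) -
     (brp a (phih u b) + brp (phih u a) b
      + phih (phip b u) a - phih (phip a u) b)).
Proof.
rewrite /jacobiator /cyclic_sum /ext_bracket /commutator; congr pair => /=.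
  rewrite !simpE !(add_lfunE, opp_lfunE, comp_lfunE) (skew_mu (phih u a)) !opprK.
  by rewrite /= [LHS](AC (2*2*2) (4*6*1*3*5*2)).
rewrite !simpE (skew_brp (phih u a)) !opprD !opprK.
by rewrite [LHS](AC (1*2*2) (1*(2*4*3*5))).
Qed.

(** The components are the defects of the sixth and fifth equations. The minus sign in the first one
    comes from turning [mu a (brp b c)] into [- mu (brp b c) a]. *)
Lemma ext_jacobiator_ppp a b c :
  jac (0, a) (0, b) (0, c) =
  (cyclic_sum (fun a b c => phip a (mu b c)) a b c
     - cyclic_sum (fun a b c => mu (brp b c) a) a b c,
   cyclic_sum (fun a b c => brp a (brp b c)) a b c
     - cyclic_sum (fun a b c => phih (mu b c) a) a b c).
Proof.
rewrite /jacobiator /cyclic_sum /ext_bracket; congr pair => /=.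
  rewrite !simpE !(skew_mu (brp _ _)) !opprD !opprK.
  by rewrite [LHS](AC (2*2*2) ((2*4*6)*(1*3*5))).
rewrite !simpE !opprD.
by rewrite [LHS](AC (2*2*2) ((1*3*5)*(2*4*6))).
Qed.

Lemma ext_jacobiator_eq0 :
  (forall u v w, jac (u, 0) (v, 0) (w, 0) = 0) ->
  (forall u v a, jac (u, 0) (v, 0) (0, a) = 0) ->
  (forall u a b, jac (u, 0) (0, a) (0, b) = 0) ->
  (forall a b c, jac (0, a) (0, b) (0, c) = 0) ->
  forall x y z, jac x y z = 0.
Proof.
move=> hhh hhp hpp ppp [u a] [v b] [w c].
have rot x y z : jac x y z = jac y z x by apply/esym/cyclic_sum_rot.
have split_pair (t : h) (d : p) : (t, d) = (t, 0) + (0, d).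
  by congr pair; rewrite /= ?addr0 ?add0r.
rewrite (split_pair u) (split_pair v) (split_pair w).
rewrite !jacobiatorDl !jacobiatorDm !jacobiatorDr.
(* Four of the eight terms vanish directly. Of the others, hph needs two rotations and phh one to
   reach hhp; php needs one and pph two to reach hpp. *)
rewrite hhh hhp hpp ppp (rot (u, 0) (0, b)) (rot (0, b)) hhp.
rewrite (rot (0, a) (v, 0)) hhp.
by rewrite (rot (0, a) (v, 0)) hpp (rot (0, a) (0, b)) (rot (0, b)) hpp !addr0.
Qed.

End ExtensionJacobiator.

Theorem proposition4p1 (R : realType) (h p : vectType R)
  (brh : {bilinear h -> h -> h}) (rhoh : {dot h for idfun})
  (omega : {skew_symmetric h}) (kahler_h : is_kahler brh rhoh omega)
  (rhop : {dot p for idfun})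
  (brp : {bilinear p -> p -> p}) (skew_brp : skew_map brp)
  (mu : {bilinear p -> p -> h}) (skew_mu : skew_map mu)
  (phip : {linear p -> 'End(h)}) (phip_sp : forall a, sp omega (phip a))
  (phih : {linear h -> 'End(p)}) (phih_so : forall u, so rhop (phih u)) :
  is_lie_bracket (ext_bracket brh brp mu phip phih) <->
  forall (u v : h) (a b c : p),
    (phip a (brh u v) =
       brh u (phip a v) + brh (phip a u) v
       + phip (phih v a) u - phip (phih u a) v) /\
    (phih u (brp a b) =
       brp a (phih u b) + brp (phih u a) b
       + phih (phip b u) a - phih (phip a u) b) /\
    (phih (brh u v) = commutator (phih u) (phih v)) /\
    (phip (brp a b) u =
       commutator (phip a) (phip b) u + brh u (mu a b)
       - mu a (phih u b) - mu (phih u a) b) /\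
    (cyclic_sum (fun a b c => brp a (brp b c)) a b c =
       cyclic_sum (fun a b c => phih (mu b c) a) a b c) /\
    (cyclic_sum (fun a b c => phip a (mu b c)) a b c =
       cyclic_sum (fun a b c => mu (brp b c) a) a b c).
Proof.
have [[skew_brh jacobi_h] _ _] := kahler_h.
split=> [[_ jacobi] u v a b c|eqs].
  have := jacobi (u, 0) (v, 0) (0, a).
  rewrite -/(jacobiator _ _ _ _) ext_jacobiator_hhp // => -[/subr0_eq e1 _].
  have := jacobi (u, 0) (0, a) (0, b).
  rewrite -/(jacobiator _ _ _ _) ext_jacobiator_hpp // => -[/subr0_eq e4 /subr0_eq e2].
  have := jacobi (0, a) (0, b) (0, c).
  rewrite -/(jacobiator _ _ _ _) ext_jacobiator_ppp // => -[/subr0_eq e6 /subr0_eq e5].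
  (* Only the third equation remains. It equates endomorphisms, so the Jacobi identity is used at an
     arbitrary vector [d] rather than at the fixed [a]. *)
  do ![split=> //]; apply/esym/subr0_eq/lfunP => d.
  have := jacobi (u, 0) (v, 0) (0, d).
  rewrite -/(jacobiator _ _ _ _) ext_jacobiator_hhp // => -[_ ->].
  by rewrite zero_lfunE.
split; first exact: ext_bracket_skew.
apply: ext_jacobiator_eq0 => [u v w|u v a|u a b|a b c].
- by rewrite ext_jacobiator_hhh [jacobiator _ _ _ _]jacobi_h.
(* All six equations share one block of five variables; those absent from the equations wanted in
   each case receive filler values, here [b] and [c]. *)
- have [e1 [_ [e3 _]]] := eqs u v a a a.
  by rewrite ext_jacobiator_hhp // e1 e3 !subrr zero_lfunE.
- have [_ [e2 [_ [e4 _]]]] := eqs u u a b b.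
  by rewrite ext_jacobiator_hpp // e2 e4 !subrr.
- have [_ [_ [_ [_ [e5 e6]]]]] := eqs 0 0 a b c.
  by rewrite ext_jacobiator_ppp // e5 e6 !subrr.
Qed.
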